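(* Let $\vdash$ be an algebraizable logic with equivalent algebraic semantics the quasivariety $\mathbf{Y}$, and let $f$ be a selector term. Every $\mathsf{PAt}$-$f$-logic $\vdash_s$ (relative to $\vdash$) is complete with respect to its corresponding $\mathsf{PAt}$-$f$-quasivariety, i.e. for every pair $(\Gamma,\phi)$ with $\Gamma\cup\{\phi\}\subseteq Tm(\mathcal{L},\mathsf{Prop})$: $$\Gamma\vdash_s\phi \iff \mathsf{QVar}^f(\vdash_s)\vDash_f(\Gamma,\phi).$$
   Context: Let $\mathcal{L}$ be an algebraic language (function symbols with arities), $\mathsf{Prop}$ a fixed countably infinite set of variables, $Tm(\mathcal{L},\mathsf{Prop})$ the set of terms (also called formulas). A consequence relation on a set $C$ is a relation between subsets of $C$ and elements of $C$ that is reflexive ($W\vdash a$ if $a\in W$) and satisfies cut (if $W\vdash v$ for all $v\in V$ and $V\vdash a$ then $W\vdash a$); all consequence relations are assumed finitary (if $W\vdash a$ then $V\vdash a$ for some finite $V\subseteq W$). A logic is a consequence relation on $Tm(\mathcal{L},\mathsf{Prop})$ that is invariant under substitutions (endomorphisms of the term algebra). $\Lambda(\vdash)$ is the complete lattice of (finitary) logics extending $\vdash$. A quasivariety is a class of algebras closed under isomorphisms, subalgebras and reduced products. For a class $\mathbf{K}$, $\Theta\vDash_{\mathbf{K}}\gamma\approx\delta$ means that every assignment into an algebra of $\mathbf{K}$ satisfying all equations in $\Theta$ satisfies $\gamma\approx\delta$. The logic $\vdash$ is algebraizable with equivalent algebraic semantics the quasivariety $\mathbf{Y}$ (of language $\mathcal{L}$),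 witnessed by a finite set $\mu(x)$ of equations in one variable and a finite set $\Delta(x,y)$ of formulas in two variables: (1) $\Gamma\vdash\phi$ iff $\mu[\Gamma]\vDash_{\mathbf{Y}}\mu(\phi)$; (2) $\Theta\vDash_{\mathbf{Y}}\gamma\approx\delta$ iff $\Delta[\Theta]\vdash\Delta(\gamma,\delta)$; (3) $\phi\dashv\vdash\Delta[\mu(\phi)]$; (4) $\gamma\approx\delta$ and $\mu[\Delta(\gamma,\delta)]$ are $\vDash_{\mathbf{Y}}$-interderivable. Here $\mu[\Gamma]$ is the union of the sets $\mu(\psi)$ for $\psi\in\Gamma$, and $\Delta[\Theta]$ is the union of the sets $\Delta(\varepsilon,\upsilon)$ for $\varepsilon\approx\upsilon$ in $\Theta$. A unary term $f(x)$ of $\mathcal{L}$ is a selector term if it is idempotent, i.e. $f(f(x))\dashv\vdash f(x)$ (each of $f(f(x))$ and $f(x)$ is derivable from the other in $\vdash$). For a formula $\chi$, $\chi[f(\overline p)/\overline p]$ is the result of substituting $f(q)$ for each variable $q$ in $\chi$; $\Gamma[f(\overline p)/\overline p]$ is defined elementwise. For $\vdash_*\in\Lambda(\vdash)$ its $\mathsf{PAt}$-$f$-variant $\vdash_*^f$ is defined by $\Gamma\vdash_*^f\phi$ iff $\Gamma[f(\overline p)/\overline p]\vdash_*\phi[f(\overline p)/\overline p]$. A $\mathsf{PAt}$-$f$-logic is a relation of the form $\vdash_*^f$ with $\vdash_*\in\Lambda(\vdash)$. For $\mathcal{A}\in\mathbf{Y}$, $\mathcal{A}^f=\{a\in A: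 f(a)=a\}$ is the set of regular elements. A polyatomic model is a pair $(\mathcal{A},v)$ with $v:\mathsf{Prop}\to\mathcal{A}^f$. $\mathcal{A},v\vDash(\Gamma,\phi)$ means: if $\mathcal{A},v\vDash\mu[\Gamma]$ then $\mathcal{A},v\vDash\mu(\phi)$. $\mathcal{A}\vDash_f(\Gamma,\phi)$ means $\mathcal{A},v\vDash(\Gamma,\phi)$ for all polyatomic models $(\mathcal{A},v)$ on $\mathcal{A}$; $\mathbf{K}\vDash_f(\Gamma,\phi)$ means $\mathcal{A}\vDash_f(\Gamma,\phi)$ for all $\mathcal{A}\in\mathbf{K}$. The $\mathsf{PAt}$-$f$-quasivariety corresponding to $\vdash_s$ is $\mathsf{QVar}^f(\vdash_s)=\{\mathcal{A}\in\mathbf{Y}:\mathcal{A}\vDash_f(\Gamma,\phi)\text{ for all }(\Gamma,\phi)\in{\vdash_s}\}$.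
   Formalization: The selector term is also assumed idempotent as an identity, f(f(a)) = f(a) in every algebra of Y; mere interderivability of f(f(x)) and f(x) is not enough (global modal logic T, f = box, refutes the claim), and completeness for all PAt-f-logics forces this identity. *)

(* Defs.v *)
From mathcomp Require Import all_boot.
From mathcomp Require Import boolp classical_sets cardinality filter.
Set Implicit Arguments.
Unset Strict Implicit.
Unset Printing Implicit Defensive.
Local Open Scope classical_set_scope.

Record language := Language { symb : Type; arity : symb -> nat }.

Inductive term (L : language) (X : Type) : Type :=
| Var of X
| App (s : symb L) of 'I_(arity s) -> term L X.
Arguments Var {L X} _.
Arguments App {L X} s _.

Definition equation (L : language) (X : Type) : Type := (term L X * term L X)%type.

Record algebra (L : language) := Algebra {
  carrier :> Type;
  op : forall s : symb L, ('I_(arity s) -> carrier) -> carrier;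
  carrier_inhabited : inhabited carrier }.
Arguments op {L} _ _ _.

Definition is_hom (L : language) (A B : algebra L) (h : A -> B) : Prop :=
  forall (s : symb L) (a : 'I_(arity s) -> A), h (op A s a) = op B s (h \o a).

Fixpoint eval (L : language) (A : algebra L) (X : Type) (v : X -> A)
    (t : term L X) : A :=
  match t with
  | Var x => v x
  | App s a => op A s (fun k => eval v (a k))
  end.

Definition satisfies (L : language) (A : algebra L) (X : Type) (v : X -> A)
    (e : equation L X) : Prop := eval v e.1 = eval v e.2.

Definition isomorphic (L : language) (A B : algebra L) : Prop :=
  exists h : A -> B, is_hom h /\ bijective h.

Definition subuniverse (L : language) (A : algebra L) (S : set A) : Prop :=
  forall (s : symb L) (a : 'I_(arity s) -> A), (forall k, S (a k)) -> S (op A s a).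

Lemma sub_inhabited (T : Type) (S : set T) : S !=set0 -> inhabited {x : T | S x}.
Proof. by case=> x Sx; exact: (inhabits (exist _ x Sx)). Qed.

Definition subalgebra (L : language) (A : algebra L) (S : set A)
    (S0 : S !=set0) (Sop : subuniverse S) : algebra L :=
  @Algebra L {x : A | S x}
    (fun s a => exist _ (op A s (fun k => sval (a k)))
                        (Sop s _ (fun k => proj2_sig (a k))))
    (sub_inhabited S0).

Section ReducedProduct.
Variables (L : language) (I : Type) (F : set_system I) (A : I -> algebra L).

Definition rp_eq (a b : forall i, A i) : Prop := F [set i | a i = b i].

Definition rp_carrier : Type :=
  {C : (forall i, A i) -> Prop | exists a, C = rp_eq a}.

Definition rp_class (a : forall i, A i) : rp_carrier :=
  exist _ (rp_eq a) (ex_intro _ a erefl).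

Definition rp_repr (C : rp_carrier) : forall i, A i := sval (cid (proj2_sig C)).

(* When F is a filter, the class of the result does not depend on the
   representatives chosen by rp_repr. *)
Definition rp_op (s : symb L) (C : 'I_(arity s) -> rp_carrier) : rp_carrier :=
  rp_class (fun i => op (A i) s (fun k => rp_repr (C k) i)).

Lemma rp_inhabited : inhabited rp_carrier.
Proof.
have c i : exists _ : A i, True by case: (carrier_inhabited (A i)) => x; exists x.
exact: (inhabits (rp_class (fun i => sval (cid (c i))))).
Qed.

Definition reduced_product : algebra L :=
  @Algebra L rp_carrier rp_op rp_inhabited.

End ReducedProduct.

(* A class is a plain predicate: the universe of [set] must not be forced above
   that of the carriers. *)
Definition algebra_class (L : language) : Type := algebra L -> Prop.

(* Only proper filters are required, so a quasivariety need not contain the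
   trivial algebra; including the improper filter would give a smaller family
   of quasivarieties. *)
Record quasivariety (L : language) (K : algebra_class L) : Prop := {
  quasivariety_iso : forall A B, isomorphic A B -> K A -> K B;
  quasivariety_sub : forall (A : algebra L) (S : set A) (S0 : S !=set0) (Sop : subuniverse S),
    K A -> K (subalgebra S0 Sop);
  quasivariety_rp : forall (I : Type) (F : set_system I) (A : I -> algebra L),
    ProperFilter F -> (forall i, K (A i)) -> K (reduced_product F A) }.

Definition formula (L : language) : Type := term L nat.

Definition formula_algebra (L : language) : algebra L :=
  @Algebra L (formula L) (@App L nat) (inhabits (Var 0)).

Definition subst (L : language) (X : Type) (s : X -> formula L) (t : term L X)
    : formula L := @eval L (formula_algebra L) X s t.

Definition inst1 (L : language) (t : term L unit) (p : formula L) : formula L :=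
  subst (fun=> p) t.

(* In a term in the two variables x, y, x is [Var true] and y is [Var false]. *)
Definition inst2 (L : language) (t : term L bool) (p q : formula L) : formula L :=
  subst (fun b : bool => if b then p else q) t.

Definition relation_on (C : Type) : Type := set C -> C -> Prop.

Record consequence (C : Type) (R : relation_on C) : Prop := {
  consequence_refl : forall (W : set C) a, W a -> R W a;
  consequence_cut : forall (W V : set C) a,
    (forall v, V v -> R W v) -> R V a -> R W a;
  consequence_finitary : forall (W : set C) a, R W a ->
    exists V : set C, [/\ finite_set V, V `<=` W & R V a] }.

Record logic (L : language) (R : relation_on (formula L)) : Prop := {
  logic_consequence : consequence R;
  logic_subst : forall h : formula_algebra L -> formula_algebra L, is_hom h ->
    forall (G : set (formula L)) phi, R G phi -> R (h @` G) (h phi) }.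

Definition extension (L : language) (R R' : relation_on (formula L)) : Prop :=
  logic R' /\ (forall G phi, R G phi -> R' G phi).

Definition derives_all (C : Type) (R : relation_on C) (W V : set C) : Prop :=
  forall v, V v -> R W v.

Definition interderivable (C : Type) (R : relation_on C) (W V : set C) : Prop :=
  derives_all R W V /\ derives_all R V W.

Definition eq_conseq (L : language) (K : algebra_class L)
    : relation_on (equation L nat) :=
  fun Theta e => forall A : algebra L, K A -> forall v : nat -> A,
    (forall e', Theta e' -> satisfies v e') -> satisfies v e.

Definition mu_app (L : language) (mu : set (equation L unit)) (p : formula L)
    : set (equation L nat) := [set (inst1 m.1 p, inst1 m.2 p) | m in mu].

Definition mu_img (L : language) (mu : set (equation L unit))
    (G : set (formula L)) : set (equation L nat) :=
  \bigcup_(p in G) mu_app mu p.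

Definition delta_app (L : language) (Delta : set (term L bool))
    (e : equation L nat) : set (formula L) :=
  [set inst2 d e.1 e.2 | d in Delta].

Definition delta_img (L : language) (Delta : set (term L bool))
    (Theta : set (equation L nat)) : set (formula L) :=
  \bigcup_(e in Theta) delta_app Delta e.

Record algebraizable (L : language) (R : relation_on (formula L))
    (Y : algebra_class L) (mu : set (equation L unit))
    (Delta : set (term L bool)) : Prop := {
  alg_logic : logic R;
  alg_quasivariety : quasivariety Y;
  alg_mu_finite : finite_set mu;
  alg_Delta_finite : finite_set Delta;
  alg_mu : forall G phi,
    R G phi <-> derives_all (eq_conseq Y) (mu_img mu G) (mu_app mu phi);
  alg_Delta : forall Theta e,
    eq_conseq Y Theta e <->
    derives_all R (delta_img Delta Theta) (delta_app Delta e);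
  alg_Delta_mu : forall phi,
    interderivable R [set phi] (delta_img Delta (mu_app mu phi));
  alg_mu_Delta : forall e,
    interderivable (eq_conseq Y) [set e] (mu_img mu (delta_app Delta e)) }.

Definition selector (L : language) (R : relation_on (formula L))
    (f : term L unit) : Prop :=
  forall q : nat, interderivable R
    [set inst1 f (inst1 f (Var q))] [set inst1 f (Var q)].

Definition fsubst (L : language) (f : term L unit) : formula L -> formula L :=
  subst (fun q => inst1 f (Var q)).

Definition pat_variant (L : language) (f : term L unit)
    (R : relation_on (formula L)) : relation_on (formula L) :=
  fun G phi => R (fsubst f @` G) (fsubst f phi).

Definition pat_logic (L : language) (R : relation_on (formula L))
    (f : term L unit) (Rs : relation_on (formula L)) : Prop :=
  exists R', extension R R' /\ Rs = pat_variant f R'.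

Definition unary_op (L : language) (A : algebra L) (f : term L unit) (a : A) : A :=
  eval (fun=> a) f.

Definition regular (L : language) (A : algebra L) (f : term L unit) : set A :=
  [set a | unary_op f a = a].

(* [selector] only says that f(f(a)) and f(a) satisfy mu simultaneously, which
   does not imply this identity: in reflexive modal algebras with the global
   consequence, box box x and box x are interderivable but not equal. The
   identity is what makes every f(a) regular, and it follows from completeness
   of the f-variant of the base logic. *)
Definition idempotent_in (L : language) (Y : algebra_class L)
    (f : term L unit) : Prop :=
  forall A : algebra L, Y A ->
    forall a : A, unary_op f (unary_op f a) = unary_op f a.

Definition polyatomic_model (L : language) (f : term L unit) (A : algebra L)
    (v : nat -> A) : Prop := forall q, regular f (v q).

Definition model_sat (L : language) (mu : set (equation L unit)) (A : algebra L)
    (v : nat -> A) (G : set (formula L)) (phi : formula L) : Prop :=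
  (forall e, mu_img mu G e -> satisfies v e) ->
  (forall e, mu_app mu phi e -> satisfies v e).

Definition alg_sat (L : language) (mu : set (equation L unit))
    (f : term L unit) (A : algebra L) (G : set (formula L)) (phi : formula L)
    : Prop :=
  forall v : nat -> A, polyatomic_model f v -> model_sat mu v G phi.

Definition class_sat (L : language) (mu : set (equation L unit))
    (f : term L unit) (K : algebra_class L) (G : set (formula L))
    (phi : formula L) : Prop :=
  forall A : algebra L, K A -> alg_sat mu f A G phi.

Definition QVar (L : language) (Y : algebra_class L)
    (mu : set (equation L unit)) (f : term L unit)
    (Rs : relation_on (formula L)) : algebra_class L :=
  fun A => Y A /\ forall G phi, Rs G phi -> alg_sat mu f A G phi.

(* Main.v *)
Require Import Defs.
From mathcomp Require Import all_boot.
From mathcomp Require Import boolp classical_sets cardinality filter.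

(** The theory generated by [f(G)] in the extension defining the f-logic induces,
    through [Delta], a congruence on formulas that is closed under the equational
    consequence of [Y].  The quotient is realised inside [Y] as the subalgebra of
    a product of refuting algebras that is the image of the formulas, and
    [q |-> [f(q)]] is a polyatomic valuation on it validating exactly the
    formulas [chi] such that [f(chi)] lies in the theory. *)

Local Open Scope classical_set_scope.

Lemma hom_eval (L : language) (A B : algebra L) (h : A -> B) (X : Type)
    (v : X -> A) (t : term L X) :
  is_hom h -> h (eval v t) = eval (fun x => h (v x)) t.
Proof.
move=> h_hom; elim: t => [//|s a IH] /=; rewrite h_hom.
by congr (op B s _); apply: funext => k /=; exact: IH.
Qed.

Lemma eval_is_hom (L : language) (A : algebra L) (v : nat -> A) :
  is_hom (eval v : formula_algebra L -> A).
Proof. by []. Qed.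

Lemma eval_subst (L : language) (A : algebra L) (X : Type) (v : nat -> A)
    (s : X -> formula L) (t : term L X) :
  eval v (subst s t) = eval (fun x => eval v (s x)) t.
Proof. exact: (hom_eval L (formula_algebra L) A (eval v)). Qed.

Lemma subst_inst1 (L : language) (s : nat -> formula L) (t : term L unit)
    (p : formula L) :
  subst s (inst1 t p) = inst1 t (subst s p).
Proof. exact: (eval_subst L (formula_algebra L)). Qed.

(** The only member of [globally [set: J]] is the full set, so each class is a singleton and this
    reduced product is the direct product. *)
Lemma rp_reprK (L : language) (J : Type) (A : J -> algebra L)
    (a : forall i, A i) (i : J) :
  rp_repr (rp_class (globally [set: J]) a) i = a i.
Proof.
rewrite /rp_repr; case: cid => b /= E.
have : rp_eq (globally [set: J]) b b by [].
by rewrite -E => /(_ i I) /= ->.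
Qed.

(** An equation outside [theta] fails in some member of [Y] under a valuation satisfying [theta]. In
    the product of these refuting algebras, taken over all excluded equations, the induced map
    identifies exactly the pairs in [theta]. *)
Lemma eq_theory_model (L : language) (Y : algebra_class L)
    (theta : set (equation L nat)) :
  quasivariety Y ->
  (forall e, eq_conseq Y theta e -> theta e) ->
  (exists e, ~ theta e) ->
  exists (B : algebra L) (h : formula_algebra L -> B),
    [/\ Y B, is_hom h, (forall b, exists p, h p = b) &
        forall p q, h p = h q <-> theta (p, q)].
Proof.
move=> qY theta_closed [e0 ne0].
pose J := {e : equation L nat | ~ theta e}.
have refute (i : J) : exists A : algebra L, Y A /\ exists v : nat -> A,
    (forall e, theta e -> satisfies v e) /\ ~ satisfies v (sval i).
  apply: contrapT => H; apply: (proj2_sig i); apply: theta_closed => A YA v vth.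
  by apply: contrapT => nv; apply: H; exists A; split=> //; exists v.
have [A AP] := choice refute.
pose v i : nat -> A i := sval (cid (proj2 (AP i))).
have vP i : (forall e, theta e -> satisfies (v i) e) /\ ~ satisfies (v i) (sval i).
  exact: (proj2_sig (cid (proj2 (AP i)))).
pose P := reduced_product (globally [set: J]) A.
have YP : Y P.
  apply: (quasivariety_rp qY) => [|i]; last by case: (AP i).
  (* The excluded equation [e0] makes the index set nonempty, hence the filter proper. *)
  exact: (@globally_properfilter J setT (exist _ e0 ne0) I).
pose g : formula_algebra L -> P :=
  fun p => rp_class (globally [set: J]) (fun i => eval (v i) p).
have g_hom : is_hom g.
  move=> s a; rewrite /= /rp_op /g /=; congr rp_class; apply: functional_extensionality_dep => i.
  by congr (op _ s _); apply: funext => k /=; rewrite rp_reprK.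
have g_eq p q : g p = g q <-> theta (p, q).
  split=> [gpq|th].
    (* The coordinate indexed by [(p, q)] itself separates [p] from [q]. *)
    apply: contrapT => nth; have [_] := vP (exist _ (p, q) nth); apply.
    rewrite /satisfies /= -(rp_reprK L J A (fun i => eval (v i) p)).
    by rewrite -/(g p) gpq rp_reprK.
  rewrite /g; congr rp_class; apply: functional_extensionality_dep => i.
  exact: (proj1 (vP i) _ th).
have S0 : range g !=set0 by exists (g (Var 0)), (Var 0).
have Sop : subuniverse (range g).
  move=> s a ag; pose p k := sval (cid2 (ag k)).
  have gp k : g (p k) = a k by rewrite /p; case: cid2.
  exists (App s p) => //; rewrite (g_hom s p); congr (op P s _).
  by apply: funext => k /=.
exists (subalgebra S0 Sop), (fun p => exist _ (g p) (ex_intro2 _ _ p I erefl)).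
split.
- exact: (quasivariety_sub qY).
- by move=> s a; apply: eq_exist; exact: g_hom.
- by move=> [b [p ? E]]; exists p; apply: eq_exist.
- move=> p q; rewrite -g_eq; split=> [[]//|E]; exact: eq_exist.
Qed.

(** An equation is put in [theta] when its [Delta]-translation lies in [T]. Since a formula is
    interderivable with [Delta[mu(p)]], membership in [T] becomes truth of [mu(p)]. *)
Lemma theory_model (L : language) (R : relation_on (formula L))
    (Y : algebra_class L) (mu : set (equation L unit)) (Delta : set (term L bool))
    (T : set (formula L)) :
  algebraizable R Y mu Delta ->
  (forall p, R T p -> T p) ->
  (exists p, ~ T p) ->
  exists (B : algebra L) (h : formula_algebra L -> B),
    [/\ Y B, is_hom h, (forall b, exists p, h p = b) &
        forall p, T p <-> forall m, mu m -> h (inst1 m.1 p) = h (inst1 m.2 p)].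
Proof.
move=> R_alg T_closed [p0 np0].
have Rcons := logic_consequence (alg_logic R_alg).
have cl W p : W `<=` T -> R W p -> T p.
  move=> WT Wp; apply: T_closed; apply: (consequence_cut Rcons) Wp => w /WT.
  exact: (consequence_refl Rcons).
pose theta : set (equation L nat) := [set e | delta_app Delta e `<=` T].
have T_mu p : T p <-> mu_app mu p `<=` theta.
  have [pD Dp] := alg_Delta_mu R_alg p; split=> [Tp e emu d de|mup].
    apply: (cl [set p]) => [_ -> //|]; apply: pD; by exists e.
  apply: (cl (delta_img Delta (mu_app mu p))); last exact: Dp.
  by move=> d [e emu de]; exact: (mup e emu d de).
have theta_closed e : eq_conseq Y theta e -> theta e.
  move=> /(alg_Delta R_alg) H d de; apply: cl (H d de) => d' [e' the' de'].
  exact: the' de'.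
(* If [theta] held every equation, [T_mu] would put every formula in [T], including [p0]. *)
have theta_proper : exists e, ~ theta e.
  apply: contrapT => H; apply: np0; apply/T_mu => e _.
  by apply: contrapT => ne; apply: H; exists e.
have [B [h [YB h_hom h_surj h_eq]]] :=
  eq_theory_model L Y theta (alg_quasivariety R_alg) theta_closed theta_proper.
exists B, h; split=> // p; split=> [/T_mu H m mum|H].
  by apply/h_eq; apply: H; exists m.
by apply/T_mu => _ [m mum <-]; apply/h_eq; exact: H.
Qed.

Lemma mu_app_sat (L : language) (mu : set (equation L unit)) (A : algebra L)
    (v : nat -> A) (p : formula L) :
  (forall e, mu_app mu p e -> satisfies v e) <->
  (forall m, mu m -> eval v (inst1 m.1 p) = eval v (inst1 m.2 p)).
Proof.
split=> [H m mum|H _ [m mum <-]]; last exact: H.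
by apply: (H (_, _)); exists m.
Qed.

Lemma model_satE (L : language) (mu : set (equation L unit)) (A : algebra L)
    (v : nat -> A) (G : set (formula L)) (phi : formula L) :
  model_sat mu v G phi <->
  ((forall g, G g -> forall e, mu_app mu g e -> satisfies v e) ->
   forall e, mu_app mu phi e -> satisfies v e).
Proof.
split=> H K; apply: H.
  by move=> e [g Gg]; exact: K.
by move=> g Gg e ge; apply: K; exists g.
Qed.

Lemma eval_fsubst (L : language) (A : algebra L) (f : term L unit)
    (v : nat -> A) (p : formula L) :
  eval v (fsubst f p) = eval (fun q => unary_op f (v q)) p.
Proof.
rewrite eval_subst; congr (eval _ p); apply: funext => q.
exact: eval_subst.
Qed.

Theorem theorem3p26 (L : language) (R : relation_on (formula L))
  (Y : algebra_class L) (mu : set (equation L unit)) (Delta : set (term L bool))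
  (f : term L unit)
  (R_alg : algebraizable R Y mu Delta)
  (f_selector : selector R f)
  (f_idem : idempotent_in Y f)
  (Rs : relation_on (formula L))
  (Rs_pat : pat_logic R f Rs)
  (G : set (formula L)) (phi : formula L) :
  Rs G phi <-> class_sat mu f (QVar Y mu f Rs) G phi.
Proof.
split=> [GP A [_]|sat]; first exact.
case: Rs_pat => R' [[R'_logic RR'] RsE].
have R'cons := logic_consequence R'_logic.
rewrite RsE /pat_variant; apply: contrapT => nphi.
pose T : set (formula L) := R' (fsubst f @` G).
have T_closed' p W : W `<=` T -> R' W p -> T p by exact: (consequence_cut R'cons).
have [//||B [h [YB h_hom h_surj T_h]]] := theory_model L R Y mu Delta T R_alg.
- by move=> p /RR'; exact: T_closed'.
- by exists (fsubst f phi).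
have h_eval t p : h (subst t p) = eval (fun q => h (t q)) p by exact: hom_eval.
have T_sat t p : T (subst t p) <->
    forall e, mu_app mu p e -> satisfies (fun q => h (t q)) e.
  rewrite mu_app_sat T_h; split=> H m mum; have := H m mum;
  by rewrite -!subst_inst1 !h_eval.
have QB : QVar Y mu f Rs B.
  split=> // D psi; rewrite RsE /pat_variant => Dpsi w w_reg; apply/model_satE.
  (* Surjectivity of [h] gives each value of [w] a representing formula, so [w] is [h] after the
     substitution [t]. *)
  pose t q := sval (cid (h_surj (w q))).
  have wE : w = fun q => h (t q) by apply: funext => q; rewrite /t; case: cid.
  have T_fsubst p : T (subst t (fsubst f p)) <->
      forall e, mu_app mu p e -> satisfies w e.
    have -> : T (subst t (fsubst f p)) <-> T (subst t p); last by rewrite wE.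
    (* The values of [w] are fixed by [f], so prefixing variables with [f] changes no value under
       [w]. *)
    have fw q : eval w (fsubst f q) = eval w q.
      by rewrite eval_fsubst; congr (eval _ q); apply: funext => k; exact: w_reg.
    rewrite !T_sat -wE !mu_app_sat; split=> H m mum; have := H m mum;
    by rewrite -!(fw (inst1 _ p)) /fsubst !subst_inst1.
  (* Invariance of [R'] under [t] carries the derivation of [psi] from [D] into the theory [T]. *)
  move=> Dw; apply/T_fsubst; apply: T_closed' (logic_subst R'_logic (h := subst t) _ Dpsi).
    by move=> _ [_ [d Dd <-] <-]; apply/T_fsubst; exact: Dw.
  exact: (eval_is_hom L (formula_algebra L)).
pose w q := h (inst1 f (Var q)).
have w_reg : polyatomic_model f w.
  move=> q; have wE : w q = unary_op f (h (Var q)) by exact: hom_eval.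
  by rewrite /regular /= wE; exact: f_idem.
have /model_satE sat_w := sat B QB w w_reg.
(* Here [T_sat] is used with the substitution defining [fsubst f], whose composite with [h] is
   [w]. *)
apply: nphi; apply/T_sat; apply: sat_w => g Gg; apply/T_sat.
by apply: (consequence_refl R'cons); exists g.
Qed.
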